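(* Let $E$ be a (not necessarily unital) operator system. The following are equivalent: (1) $E$ is approximately generated by positives, that is, $\overline{\operatorname{span}}(E_+) = E$. (2) The zero map $\delta_0 : E \to \mathbb{C}$ is an extremal point of $E$.
   Context: An operator system is a norm-closed subspace $E \subseteq B(H)$ ($H$ a Hilbert space) closed under the adjoint; it need not contain the unit of $B(H)$. $M_d(E)\subseteq M_d(B(H))=B(H^d)$ carries the inherited norm and positive cone $M_d(E)_+ = M_d(E)\cap B(H^d)_+$; $E_+ = M_1(E)_+$. A cpcc map is a linear map that is completely positive (positive on every $M_d(E)$ with respect to these cones) and completely contractive. Dilation order: for cpcc maps $\phi:E\to B(H)$, $\psi:E\to B(K)$, write $\phi\preceq\psi$ if there is an isometry $V:H\to K$ with $\phi(x)=V^*\psi(x)V$ for all $x\in E$. The map $\phi$ is maximal in dilation order if every dilation is trivial: whenever $\psi$ is cpcc and $\phi = V^*\psi V$ with $V$ an isometry, then $\psi=\phi\oplus\zeta$ with respect to $K = VH\oplus (VH)^\perp$ (identifying $H$ with $VH$) for some cpcc map $\zeta$. Extremal point: for a (possibly infinite) cardinal $n\ge 1$, let $QS_n(E)$ be the convex set of cpcc maps $E\to B(\ell^2(n))$. A cpcc map $\phi:E\to B(\ell^2(n))$ is an extremal point of $E$ if $\phi$ is an extreme point of the convex set $QS_n(E)$ and $\phi$ is maximal in dilation order. The zero map $\delta_0$ is regarded as the element $0$ of $QS_1(E)$, i.e. $\delta_0:E\to\mathbb{C}=B(\ell^2(1))$, $\delta_0(x)=0$. *)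

(* Defs.v *)
From HB Require Import structures.
From mathcomp Require Import all_boot all_order all_algebra.
From mathcomp Require Import all_classical all_reals.
From mathcomp Require Import topology normedtype.
From mathcomp Require Import sesquilinear complex ring lra.

Set Implicit Arguments.
Unset Strict Implicit.
Unset Printing Implicit Defensive.

Import Order.TTheory GRing.Theory Num.Theory.
Import numFieldNormedType.Exports.

Local Open Scope classical_set_scope.
Local Open Scope complex_scope.
Local Open Scope ring_scope.

(* The inner product is linear in its first argument and conjugate-linear in the
   second one. *)
HB.mixin Record isHilbert (R : realType) H & CompleteNormedModule R[i] H := {
  inner : {dot H for Num.conj};
  inner_norm : forall x : H, inner x x = `|x| ^+ 2
}.

#[short(type="hilbertType")]
HB.structure Definition Hilbert (R : realType) :=
  {H of isHilbert R H & CompleteNormedModule R[i] H}.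

Section Dot.
Context (C : numClosedFieldType) (V : lmodType C).

Section DotOf.
Context (f : V -> V -> C).
Hypotheses (f_scalar : forall z, scalar (f ^~ z))
  (f_conj : forall x y, f x y = (f y x)^*)
  (f_gt0 : forall x, x != 0 -> 0 < f x x).

Let fDl z : zmod_morphism (f ^~ z).
Proof. exact: zmod_morphism_linear (f_scalar z). Qed.
Let fDr z : zmod_morphism (f z).
Proof. by move=> x y; rewrite f_conj fDl rmorphB/= -!f_conj. Qed.
Let fZl z : scalable_for *%R (f ^~ z).
Proof. exact: scalable_linear (f_scalar z). Qed.
Let fZr z : scalable_for (Num.conj \; *%R) (f z).
Proof. by move=> a x; rewrite f_conj fZl rmorphM/= -f_conj. Qed.
Let fC x y : f x y = (-1) ^+ false * (f y x)^*.
Proof. by rewrite expr0 mul1r -f_conj. Qed.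

HB.instance Definition _ := isBilinear.Build C V V C _ _ f fDl fDr fZl fZr.
HB.instance Definition _ := isHermitianSesquilinear.Build C V false Num.conj f fC.
HB.instance Definition _ := isDotProduct.Build C V f f_gt0.

Definition dot_of : {dot V for Num.conj} := f.

End DotOf.

Context (f : {dot V for Num.conj}).
Implicit Types u v : V.

Lemma dotC u v : f u v = (f v u)^*.
Proof. by rewrite (hermC f) expr0 mul1r. Qed.

Lemma dot_CS u v : `|f u v| <= sqrtC (f u u) * sqrtC (f v v).
Proof.
have [->|v0] := eqVneq v 0; first by rewrite !linear0r sqrtC0 mulr0 normr0.
have vgt0 : 0 < f v v by rewrite (dnorm_gt0 f).
rewrite -(@ler_pXn2r _ 2)// ?nnegrE ?mulr_ge0 ?(sqrt_dnorm_ge0 f)//.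
rewrite exprMn !sqrtCK normCK.
pose a := f u v / f v v.
have := dnorm_ge0 f (u - a *: v).
rewrite (dnormB f) (dnormZ f) linearZr_LR/=.
have vR : (f v v)^* = f v v by rewrite -dotC.
have aE : (a)^* = (f u v)^* / f v v by rewrite rmorphM/= fmorphV/= vR.
have -> : a^* * f u v = f u v * (f u v)^* / f v v.
  by rewrite aE mulrAC [_^* * _]mulrC.
rewrite !rmorphM/= conjCK fmorphV/= vR [_^* * f u v]mulrC normCK aE.
have -> : f u v / f v v * ((f u v)^* / f v v) * f v v =
          f u v * (f u v)^* / f v v.
  by rewrite -!mulrA mulVf ?gt_eqF// mulr1 [_^-1 * _]mulrC.
rewrite opprD addrA addrK subr_ge0 ler_pdivrMr//.
Qed.

Lemma dot_triangle u v :
  sqrtC (f (u + v) (u + v)) <= sqrtC (f u u) + sqrtC (f v v).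
Proof.
rewrite -(@ler_pXn2r _ 2)// ?nnegrE ?addr_ge0 ?(sqrt_dnorm_ge0 f)//.
rewrite sqrrD !sqrtCK (dnormD f)/= addrAC lerD2r lerD2l.
have -> : f u v + (f u v)^* = 'Re (f u v) *+ 2.
  by rewrite ReE -[_ / 2 *+ 2]mulr_natr divfK// pnatr_eq0.
rewrite lerMn2r/=; apply: le_trans (dot_CS u v).
exact: (leif_Re_Creal _).1.
Qed.

End Dot.

(* Builds the norm |x| = sqrt <x, x> and its topology from the inner product;
   form_complete states that Cauchy filters for this norm converge. *)
HB.factory Record PreHilbert_isHilbert (R : realType) H
    & GRing.Lmodule R[i] H := {
  form : {dot H for Num.conj};
  form_complete : forall F : set_system H, ProperFilter F ->
    (forall e : R[i], 0 < e ->
       exists x, F [set y | sqrtC (form (x - y) (x - y)) < e]) ->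
    exists x, forall e : R[i], 0 < e ->
       F [set y | sqrtC (form (x - y) (x - y)) < e]
}.

HB.builders Context R H & PreHilbert_isHilbert R H.

Let norm (x : H) : R[i] := sqrtC (form x x).

Let normD x y : norm (x + y) <= norm x + norm y.
Proof. exact: dot_triangle. Qed.

Let normZ (l : R[i]) (x : H) : norm (l *: x) = `|l| * norm x.
Proof.
rewrite /norm (dnormZ form) sqrtCM ?nnegrE ?exprn_ge0// ?dnorm_ge0//.
by rewrite exprCK.
Qed.

Let norm0 (x : H) : norm x = 0 -> x = 0.
Proof. by move/eqP; rewrite sqrt_dnorm_eq0 => /eqP. Qed.

HB.instance Definition _ := Lmodule_isNormed.Build R[i] H normD normZ norm0.

Let cmpl (F : set_system H) : ProperFilter F -> cauchy F -> cvg F.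
Proof.
move=> PF /cauchyP Fc.
have [|x xF] := form_complete PF.
  move=> e /Fc[x]; rewrite -ball_normE => xF; exists x; exact: xF.
apply/cvg_ex; exists x; apply/cvgrPdist_lt => e e0; exact: xF.
Qed.

HB.instance Definition _ := Uniform_isComplete.Build H cmpl.

Let nrm (x : H) : form x x = `|x| ^+ 2.
Proof. by rewrite /Num.norm/= /norm sqrtCK. Qed.

HB.instance Definition _ := isHilbert.Build R H nrm.
HB.end.

Section HilbertTheory.
Context (R : realType) (H : hilbertType R).
Implicit Types x y : H.

Lemma sqrt_inner x : sqrtC (inner x x) = `|x|.
Proof. by rewrite inner_norm sqrCK. Qed.

Lemma innerC x y : inner x y = (inner y x)^*.
Proof. exact: dotC. Qed.

Lemma inner_CS x y : `|inner x y| <= `|x| * `|y|.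
Proof. by rewrite (le_trans (dot_CS _ _ _))// !sqrt_inner. Qed.

End HilbertTheory.

(* The complex numbers as a one-dimensional Hilbert space, i.e. l^2(1); an alias,
   since the regular module R[i]^o already carries generic instances. *)
Definition hilbC (R : realType) := R[i].

Section HilbC.
Context (R : realType).
Local Notation C := R[i].

HB.instance Definition _ := GRing.Lmodule.copy (hilbC R) C^o.

Let C_form (z w : hilbC R) : C := (z : C) * (w : C)^*.

Let C_form_scalar w : scalar (C_form ^~ w).
Proof. by move=> a x y; rewrite /C_form mulrDl -mulrA. Qed.
Let C_form_conj z w : C_form z w = (C_form w z)^*.
Proof. by rewrite /C_form rmorphM/= conjCK mulrC. Qed.
Let C_form_gt0 z : z != 0 -> 0 < C_form z z.
Proof. by move=> z0; rewrite /C_form mul_conjC_gt0. Qed.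

Let C_dot : {dot hilbC R for Num.conj} :=
  dot_of C_form_scalar C_form_conj C_form_gt0.

Let C_complete (F : set_system (hilbC R)) : ProperFilter F ->
  (forall e : C, 0 < e ->
     exists x, F [set y | sqrtC (C_dot (x - y) (x - y)) < e]) ->
  exists x, forall e : C, 0 < e ->
     F [set y | sqrtC (C_dot (x - y) (x - y)) < e].
Proof.
move=> PF Fc.
have dE (z : C) : sqrtC (C_dot z z) = `|z|.
  by rewrite /C_dot/= /dot_of/= /C_form -normCK sqrCK.
have ReL (z : C) : `|complex.Re z|%:C <= `|z| by exact: normc_ge_Re.
have ImL (z : C) : `|complex.Im z|%:C <= `|z|.
  have -> : complex.Im z = complex.Re (- 'i * z).
    by rewrite mulNr raddfN/= mulrC ReiNIm opprK.
  by rewrite (le_trans (ReL _))// normrM normrN normCi mul1r.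
have sub (p : C -> R) : {morph p : x y / x - y} ->
    (forall z, `|p z|%:C <= `|z|) -> cvg (p @ (F : set_system C)).
  move=> pB pL; apply: R_complete.
  apply: cauchy_exP => e e0; have := Fc e%:C.
  rewrite ltcR => /(_ e0)[z Fz]; exists (p z).
  rewrite /fmap/=; apply: filterS Fz => w; rewrite /= dE -!ball_normE/= => zw.
  by rewrite -ltcR -pB (le_lt_trans (pL _)).
have /cvg_ex[a aF] := sub _ (raddfB _) ReL.
have /cvg_ex[b bF] := sub _ (raddfB _) ImL.
exists (a +i* b) => e e0.
have eE : e = (complex.Re e)%:C by rewrite RRe_real ?gtr0_real.
have e20 : 0 < complex.Re e / 2 by rewrite divr_gt0// -ltcR -eE.
have /cvgrPdist_lt/(_ _ e20) aFe := aF.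
have /cvgrPdist_lt/(_ _ e20) bFe := bF.
apply: filterS2 aFe bFe => z /= az bz.
rewrite dE eE [complex.Re e]splitr.
have -> : ((a +i* b : C) - z) =
   (a - complex.Re z)%:C + 'i * (b - complex.Im z)%:C :> C.
  by rewrite [LHS]complexE; case: z {az bz}.
rewrite (le_lt_trans (ler_normD _ _))// normrM normCi mul1r.
rewrite !normc_def/= !expr0n/= !addr0 !sqrtr_sqr -rmorphD/= ltcR ltrD//.
Qed.

HB.instance Definition _ := PreHilbert_isHilbert.Build R (hilbC R) C_complete.

End HilbC.

(* The Hilbert direct sum H^d, with <x, y> = \sum_i <x i, y i>; an alias, so as
   not to inherit the product topology instances of functions. *)
Definition hpow (d : nat) (H : Type) := 'I_d -> H.

Section DirectSum.
Context (R : realType) (H : hilbertType R) (d : nat).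

HB.instance Definition _ := GRing.Lmodule.copy (hpow d H) ('I_d -> H).

Let hpow_form (x y : hpow d H) : R[i] := \sum_(i < d) inner (x i) (y i).

Let hpow_scalar y : scalar (hpow_form ^~ y).
Proof.
move=> a x z; rewrite /hpow_form mulr_sumr -big_split/=.
by apply: eq_bigr => i _; rewrite linearPl.
Qed.

Let hpow_conj x y : hpow_form x y = (hpow_form y x)^*.
Proof. by rewrite rmorph_sum/=; apply: eq_bigr => i _; rewrite innerC. Qed.

Let hpow_gt0 x : x != 0 -> 0 < hpow_form x x.
Proof.
move=> x0; rewrite lt_def sumr_ge0 ?andbT; last first.
  by move=> i _; exact: dnorm_ge0.
apply: contra x0; rewrite psumr_eq0; last by move=> i _; exact: dnorm_ge0.
move=> /allP x0; apply/eqP/funext => i.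
by have := x0 i (mem_index_enum _); rewrite /= dnorm_eq0 => /eqP.
Qed.

Let hpow_dot : {dot hpow d H for Num.conj} :=
  dot_of hpow_scalar hpow_conj hpow_gt0.

Let hpow_complete (F : set_system (hpow d H)) : ProperFilter F ->
  (forall e : R[i], 0 < e ->
     exists x, F [set y | sqrtC (hpow_dot (x - y) (x - y)) < e]) ->
  exists x, forall e : R[i], 0 < e ->
     F [set y | sqrtC (hpow_dot (x - y) (x - y)) < e].
Proof.
move=> PF Fc.
have dE x : hpow_form x x = \sum_(i < d) `|x i| ^+ 2.
  by apply: eq_bigr => i _; rewrite inner_norm.
have cvgi i : cvg ((fun x : hpow d H => x i) @ F).
  apply: cauchy_cvg; apply: cauchy_exP => e /Fc[x xF]; exists (x i).
  rewrite /fmap/=; apply: filterS xF => y /=; rewrite -ball_normE/= dE.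
  apply: le_lt_trans; rewrite -[leLHS]sqrCK// ler_sqrtC ?nnegrE ?exprn_ge0//.
    by rewrite (bigD1 i)//= lerDl sumr_ge0// => j _; rewrite exprn_ge0.
  by rewrite sumr_ge0// => j _; rewrite exprn_ge0.
exists (fun i => lim ((fun x : hpow d H => x i) @ F)) => e e0.
set l : hpow d H := fun i => _.
have e'0 : 0 < e / d.+1%:R by rewrite divr_gt0.
have : \forall y \near F, forall i, `|l i - y i| < e / d.+1%:R.
  by apply: filter_forall => i; have /cvgrPdist_lt/(_ _ e'0) := cvgi i.
apply: filterS => y /= ly; rewrite dE.
rewrite -[ltRHS](sqrCK (ltW e0)) ltr_sqrtC ?nnegrE ?exprn_ge0 ?(ltW e0)//; last first.
  by rewrite sumr_ge0// => j _; rewrite exprn_ge0.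
apply: (@le_lt_trans _ _ (\sum_(i < d) (e / d.+1%:R) ^+ 2)).
  by apply: ler_sum => i _; rewrite lerXn2r ?nnegrE ?(ltW (ly _)) ?(ltW e'0).
rewrite sumr_const card_ord -[ltLHS]mulr_natr expr_div_n mulrAC.
rewrite ltr_pdivrMr ?exprn_gt0// ltr_pM2l ?exprn_gt0//.
rewrite -natrX ltr_nat (@leq_ltn_trans (d * d.+1))// ?leq_pmulr//.
by rewrite expnS expn1 ltn_pmul2r.
Qed.

HB.instance Definition _ := PreHilbert_isHilbert.Build R (hpow d H) hpow_complete.

End DirectSum.

Section OrthogonalComplement.
Context (R : realType) (H : hilbertType R) (A : set H).

Definition orthogonal_to : {pred H} :=
  fun x => `[< forall a, A a -> inner x a = 0 >].

Let orthogonal_to_submod : submod_closed orthogonal_to.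
Proof.
split=> [|a x y /asboolP x0 /asboolP y0]; apply/asboolP => z Az.
  by rewrite linear0l.
by rewrite linearPl/= x0// y0// mulr0 addr0.
Qed.

HB.instance Definition _ :=
  GRing.isSubmodClosed.Build R[i] H orthogonal_to orthogonal_to_submod.

Record ocompl := Ocompl { oval :> H; ovalP : oval \in orthogonal_to }.
HB.instance Definition _ := [isSub for oval].
HB.instance Definition _ := [Choice of ocompl by <:].
HB.instance Definition _ := [SubChoice_isSubLmodule of ocompl by <:].

Let oform (x y : ocompl) : R[i] := inner (oval x) (oval y).

Let oform_scalar y : scalar (oform ^~ y).
Proof. by move=> a x z; exact: (linearPl inner (oval y) a (oval x) (oval z)). Qed.
Let oform_conj x y : oform x y = (oform y x)^*.
Proof. exact: innerC. Qed.
Let oform_gt0 x : x != 0 -> 0 < oform x x.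
Proof. by move=> x0; rewrite /oform dnorm_gt0. Qed.

Let odot : {dot ocompl for Num.conj} := dot_of oform_scalar oform_conj oform_gt0.

Let ocompl_complete (F : set_system ocompl) : ProperFilter F ->
  (forall e : R[i], 0 < e ->
     exists x, F [set y | sqrtC (odot (x - y) (x - y)) < e]) ->
  exists x, forall e : R[i], 0 < e ->
     F [set y | sqrtC (odot (x - y) (x - y)) < e].
Proof.
move=> PF Fc.
have dE (x y : ocompl) : sqrtC (odot (x - y) (x - y)) = `|oval x - oval y|.
  by rewrite -sqrt_inner /odot/= /dot_of/= /oform linearB.
have /cvg_ex[l lF] : cvg (oval @ F).
  apply: cauchy_cvg; apply: cauchy_exP => e /Fc[x xF]; exists (oval x).
  by rewrite /fmap/=; apply: filterS xF => y /=; rewrite dE -ball_normE.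
have lP : l \in orthogonal_to.
  apply/asboolP => a Aa; apply/eqP; rewrite -normr_le0.
  apply/ler_addgt0Pr => e e0; rewrite add0r.
  have e'0 : 0 < e / (`|a| + 1) by rewrite divr_gt0// ltr_wpDl.
  have /cvgrPdist_lt/(_ _ e'0)/filter_ex[y /= ly] := lF.
  have /asboolP/(_ _ Aa) ya := ovalP y.
  have -> : inner l a = inner (l - oval y) a by rewrite linearBl/= ya subr0.
  rewrite (le_trans (inner_CS _ _))// (@le_trans _ _ (e / (`|a| + 1) * `|a|))//.
    by rewrite ler_wpM2r// ltW.
  rewrite mulrAC ler_pdivrMr ?ltr_wpDl// ler_pM2l// lerDl//.
exists (Ocompl lP) => e e0; have /cvgrPdist_lt/(_ _ e0) := lF.
by apply: filterS => y /=; rewrite dE.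
Qed.

HB.instance Definition _ := PreHilbert_isHilbert.Build R ocompl ocompl_complete.

End OrthogonalComplement.

Section BoundedOperators.
Context (R : realType) (H K : hilbertType R).
Local Notation C := R[i].

Definition bounded_linear : {pred H -> K} :=
  fun f => `[< linear f /\ continuous f >].

Let bounded_linear_submod : submod_closed bounded_linear.
Proof.
split=> [|a f g /asboolP[fl fc] /asboolP[gl gc]]; apply/asboolP; split.
- by move=> a x y; rewrite scaler0 addr0.
- by move=> x; exact: cst_continuous.
- move=> b x y.
  rewrite -[LHS]/(a *: f (b *: x + y) + g (b *: x + y)).
  rewrite -[RHS]/(b *: (a *: f x + g x) + (a *: f y + g y)) fl gl !scalerDr.
  by rewrite addrACA !scalerA [b * a]mulrC.
- by move=> x; apply: continuousD; [apply: continuousZr; exact: fc|exact: gc].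
Qed.

HB.instance Definition _ := GRing.isSubmodClosed.Build C (H -> K)
  bounded_linear bounded_linear_submod.

(* B(H, K), later equipped with the operator norm. *)
Record bop := Bop { bop_fun :> H -> K; bopP : bop_fun \in bounded_linear }.
HB.instance Definition _ := [isSub for bop_fun].
HB.instance Definition _ := [Choice of bop by <:].
HB.instance Definition _ := [SubChoice_isSubLmodule of bop by <:].

Lemma bop_linear (f : bop) : linear f.
Proof. by have /asboolP[] := bopP f. Qed.

Lemma bop_continuous (f : bop) : continuous f.
Proof. by have /asboolP[] := bopP f. Qed.

HB.instance Definition _ (f : bop) :=
  GRing.isLinear.Build C H K *:%R (bop_fun f) (bop_linear f).

End BoundedOperators.

Section BoundedOperatorsNorm.
Context (R : realType) (H K : hilbertType R).
Local Notation C := R[i].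
Implicit Types f g : bop H K.

Lemma bounded_linearP (f : H -> K) (M : C) : linear f ->
  (forall x, `|f x| <= M * `|x|) -> f \in @bounded_linear R H K.
Proof.
move=> fl fM; apply/asboolP; split=> // x.
have fB y : f x - f y = f (x - y).
  by rewrite -scaleN1r addrC -fl scaleN1r addrC.
apply/cvgrPdist_lt => e e0.
have M0 : 0 < `|M| + 1 by rewrite ltr_wpDl.
have : \forall y \near x, `|x - y| < e / (`|M| + 1).
  by apply: (@cvgr_dist_lt _ _ _ _ _ id x) => //; rewrite divr_gt0.
apply: filterS => y; rewrite ltr_pdivlMr// => xy.
rewrite fB (le_lt_trans (fM _))//; apply: le_lt_trans xy.
rewrite mulrC mulrDr mulr1 ler_wpDr//.
have [->|n0] := eqVneq `|x - y| 0; first by rewrite !mul0r.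
have np : 0 < `|x - y| by rewrite lt_def n0 normr_ge0.
have M_ge0 : 0 <= M.
  by rewrite -(pmulr_lge0 _ np) (le_trans (normr_ge0 _) (fM _)).
by rewrite (ger0_norm M_ge0).
Qed.

Definition opnorm f : R :=
  sup [set complex.Re `|f x| | x in [set x : H | `|x| <= 1]].

Let normE (V : hilbertType R) (x : V) : `|x| = (complex.Re `|x|)%:C.
Proof. by rewrite RRe_real// normr_real. Qed.

Let opnorm_has_sup f :
  has_sup [set complex.Re `|f x| | x in [set x : H | `|x| <= 1]].
Proof.
split; first by exists (complex.Re `|f 0|), 0; rewrite /= ?normr0 ?ler01.
have : bounded_near f (nbhs (0 : H)).
  apply: continuous_linear_bounded; exact: bop_continuous.
move=> /linear_boundedP /pinfty_ex_gt0[r r0 fr].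
exists (complex.Re r) => _ [x /= x1 <-].
rewrite -lecR -normE RRe_real ?gtr0_real//.
by rewrite (le_trans (fr x))// ler_piMr// ltW.
Qed.

Let opnorm_ge0 f : 0 <= opnorm f.
Proof.
apply: le_trans (ub_le_sup (opnorm_has_sup f).2 _); last first.
  by exists 0 => //=; rewrite normr0 ler01.
by rewrite raddf0 normr0.
Qed.

Let opnormP f x : `|f x| <= (opnorm f)%:C * `|x|.
Proof.
have [->|x0] := eqVneq x 0; first by rewrite raddf0 !normr0 mulr0.
have nx : 0 < `|x| by rewrite normr_gt0.
rewrite -ler_pdivrMr//.
have -> : `|f x| / `|x| = `|f (`|x|^-1 *: x)|.
  by rewrite linearZ/= normrZ normfV normr_id mulrC.
rewrite normE lecR; apply: ub_le_sup; first exact: (opnorm_has_sup f).2.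
exists (`|x|^-1 *: x) => //=.
by rewrite normrZ normfV normr_id mulVf ?gt_eqF.
Qed.

Let opnorm_le f (c : R) : (forall x, `|f x| <= c%:C * `|x|) -> 0 <= c ->
  opnorm f <= c.
Proof.
move=> fc c0; apply: ge_sup; first exact: (opnorm_has_sup f).1.
move=> _ [x /= x1 <-]; rewrite -lecR -normE (le_trans (fc x))//.
by rewrite ler_piMr// ler0c.
Qed.

Let norm f : C := (opnorm f)%:C.

Let normD f g : norm (f + g) <= norm f + norm g.
Proof.
rewrite /norm -rmorphD/= lecR opnorm_le ?addr_ge0// => x.
rewrite rmorphD/= mulrDl (le_trans _ (lerD (opnormP f x) (opnormP g x)))//.
exact: ler_normD.
Qed.

Let normZ_le (a : C) f : norm (a *: f) <= `|a| * norm f.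
Proof.
have aE : `|a| = (complex.Re `|a|)%:C by rewrite RRe_real// normr_real.
rewrite /norm aE -rmorphM/= lecR opnorm_le//; last first.
  by rewrite mulr_ge0// -ler0c -aE.
move=> x; rewrite rmorphM/= -aE -mulrA.
by rewrite -[leLHS]/(`|a *: f x|) normrZ ler_wpM2l.
Qed.

Let normZ (a : C) f : norm (a *: f) = `|a| * norm f.
Proof.
have [->|a0] := eqVneq a 0.
  rewrite scale0r normr0 mul0r; apply/le_anti/andP; split; last by rewrite ler0c.
  by have := normZ_le 0 0; rewrite scale0r normr0 mul0r.
apply/le_anti/andP; split; first exact: normZ_le.
rewrite -ler_pdivlMl ?normr_gt0//.
rewrite -normfV; apply: le_trans (normZ_le _ _).
by rewrite scalerA mulVf// scale1r.
Qed.

Let norm0 f : norm f = 0 -> f = 0.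
Proof.
move=> f0; apply/val_inj/funext => x; apply/eqP.
by rewrite -[_ == _]/(f x == 0) -normr_le0 (le_trans (opnormP f x))// -/(norm f) f0 mul0r.
Qed.

HB.instance Definition _ :=
  Lmodule_isNormed.Build C (bop H K) normD normZ norm0.

Lemma bop_normE f : `|f| = (opnorm f)%:C.
Proof. by []. Qed.

Lemma bop_normP f x : `|f x| <= `|f| * `|x|.
Proof. exact: opnormP. Qed.

End BoundedOperatorsNorm.

Section Riesz.
Context (R : realType) (H : hilbertType R).
Local Notation C := R[i].
Context (f : H -> C) (M : R).
Hypotheses (f_lin : scalar f) (f_bnd : forall x, `|f x| <= M%:C * `|x|).

Let n (x : H) : R := complex.Re `|x|.
Let q (x : H) : R := n x ^+ 2.
Let g (x : H) : R := complex.Re (f x).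
Let B (x y : H) : R := complex.Re (inner x y).
Let J (x : H) : R := q x - 2 * g x.

Let nE x : `|x| = (n x)%:C.
Proof. by rewrite /n RRe_real// normr_real. Qed.

Let n_ge0 x : 0 <= n x.
Proof. by rewrite -ler0c -nE. Qed.

Let qE x : inner x x = (q x)%:C.
Proof. by rewrite inner_norm nE rmorphXn. Qed.

Let g_bnd x : g x <= M * n x.
Proof.
rewrite (le_trans (ler_norm _))// -lecR (le_trans (normc_ge_Re _))//.
by rewrite (le_trans (f_bnd _))// rmorphM/= -nE.
Qed.

Let B_bnd x y : `|B x y| <= n x * n y.
Proof.
rewrite -lecR (le_trans (normc_ge_Re _))// (le_trans (inner_CS _ _))//.
by rewrite rmorphM/= -!nE.
Qed.

Let J_line x h (t : R) :
  J (x + t%:C *: h) = J x + 2 * t * B x h + t ^+ 2 * q h - 2 * t * g h.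
Proof.
have gE : g (x + t%:C *: h) = g x + t * g h.
  rewrite addrC /g f_lin raddfD/= addrC; congr (_ + _).
  by case: (f h) => a b /=; rewrite mul0r subr0.
have qE' : q (x + t%:C *: h) = q x + t ^+ 2 * q h + 2 * t * B x h.
  apply: complexI; rewrite -qE (dnormD inner)/= (dnormZ inner) !qE.
  rewrite linearZr_LR/= real_normK ?complex_real ?eqxx//.
  have tC : (t%:C)^* = t%:C :> C by rewrite conj_Creal ?complex_real ?eqxx.
  rewrite tC (rmorphM Num.conj)/= tC -mulrDr.
  have -> : inner x h + (inner x h)^* = 2%:R * (B x h)%:C by exact: addcJ.
  rewrite !rmorphD/= !rmorphM/= -[2%:C]/(real_complex R 2%:R) rmorph_nat.
  by ring.
by rewrite /J gE qE'; ring.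
Qed.

Let J_ge x : - M ^+ 2 <= J x.
Proof.
rewrite /J /q -subr_ge0; have := g_bnd x; have := sqr_ge0 (n x - M).
by rewrite sqrrB; nra.
Qed.

Let m : R := inf (range J).

Let J_has_inf : has_inf (range J).
Proof.
split; first by exists (J 0), 0.
by exists (- M ^+ 2) => _ [x _ <-].
Qed.

Let m_le x : m <= J x.
Proof. by apply: ge_inf; [exact: J_has_inf.2|exists x]. Qed.

Let J_near (e : R) : 0 < e -> exists x, J x < m + e.
Proof.
move=> e0; have [_ [x _ <-] xe] := inf_adherent e0 J_has_inf.
by exists x.
Qed.

Let J_dist x y (e : R) : J x < m + e -> J y < m + e -> q (x - y) < 4 * e.
Proof.
move=> xe ye; have := J_line x (y - x) 1; have := J_line x (y - x) (2^-1).
rewrite scale1r [x + (y - x)]addrC subrK => J2 J1.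
have := m_le (x + (2^-1)%:C *: (y - x)).
have -> : q (x - y) = q (y - x) by rewrite /q /n distrC.
rewrite J2; move: J1 xe ye; rewrite expr1n !mulr1 expr2; nra.
Qed.

Let F : set_system H :=
  fun A => exists2 e : R, 0 < e & [set x | J x < m + e] `<=` A.

Let F_filter : ProperFilter F.
Proof.
split; first by move=> [e /J_near[x xe] /(_ x xe)].
split; first by exists 1.
- move=> P Q [e e0 eP] [d d0 dQ]; exists (Num.min e d).
    by rewrite lt_min e0 d0.
  by move=> x /= xed; split; [apply: eP|apply: dQ];
    rewrite /= (lt_le_trans xed)// lerD2l ge_min lexx ?orbT.
- by move=> P Q PQ [e e0 eP]; exists e => //; exact: subset_trans PQ.
Qed.

Lemma riesz : exists z, forall x, f x = inner x z.
Proof.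
have FF : ProperFilter F := F_filter.
have /cvg_ex[z zF] : cvg F.
  apply: cauchy_cvg; apply: cauchy_exP => e e0.
  have eE : e = (complex.Re e)%:C by rewrite RRe_real ?gtr0_real.
  set r := complex.Re e in eE; have r0 : 0 < r by rewrite -ltcR -eE.
  have d0 : 0 < r ^+ 2 / 4 by rewrite divr_gt0// exprn_gt0.
  have [x xd] := J_near d0; exists x, (r ^+ 2 / 4) => // y yd.
  rewrite -ball_normE/= nE eE ltcR -(@ltr_pXn2r _ 2)// ?nnegrE ?(ltW r0)//.
  by have := J_dist xd yd; rewrite mulrC divfK// pnatr_eq0.
have BE h : B z h = g h.
  have D_ge (t : R) : 0 <= 2 * t * (B z h - g h) + t ^+ 2 * q h.
    apply/ler_addgt0Pr => e e0.
    pose d := e / (4 * (`|t| * n h + 1)).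
    have tn0 : 0 <= `|t| * n h by rewrite mulr_ge0.
    have d0 : 0 < d by rewrite divr_gt0// mulr_gt0// ltr_wpDl.
    have e20 : 0 < e / 2 by rewrite divr_gt0.
    have dC0 : 0 < d%:C :> C by rewrite ltcR.
    have zd : F (ball z d%:C) by apply: zF; exact: nbhsx_ballx.
    have Fe : F [set y | J y < m + e / 2] by exists (e / 2).
    have [y /= []] := filter_ex (filterI zd Fe).
    rewrite -ball_normE/= => zy ye.
    have := m_le (y + t%:C *: h); rewrite J_line => mle.
    have BE : B z h = B y h + B (z - y) h.
      by rewrite /B -raddfD/= -linearDl/= addrC subrK.
    have Bd : `|2 * t * B (z - y) h| <= e / 2.
      have dE : d * (4 * (`|t| * n h + 1)) = e.
        by rewrite /d divfK// gt_eqF// mulr_gt0// ltr_wpDl.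
      have tB : `|t| * `|B (z - y) h| <= `|t| * (d * n h).
        rewrite ler_wpM2l// (le_trans (B_bnd _ _))// ler_wpM2r//.
        by rewrite ltW// -ltcR -nE.
      by rewrite !normrM (ger0_norm (ler0n _ 2)); nra.
    move: Bd; rewrite ler_norml => /andP[+ _]; rewrite BE; nra.
  have q0 : 0 <= q h by rewrite sqr_ge0.
  apply/eqP; rewrite -subr_eq0; set D := B z h - g h in D_ge *.
  have := D_ge (- D / (q h + 1)).
  have q1 : 0 < q h + 1 by rewrite ltr_wpDl.
  have -> : 2 * (- D / (q h + 1)) * D + (- D / (q h + 1)) ^+ 2 * q h =
     - (D ^+ 2 * (q h + 2)) / (q h + 1) ^+ 2.
    by field; rewrite gt_eqF.
  rewrite pmulr_lge0 ?invr_gt0 ?exprn_gt0// oppr_ge0 pmulr_lle0; last first.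
    by rewrite ltr_wpDl.
  by rewrite exprn_even_le0.
have ReE h : complex.Re (f h) = complex.Re (inner h z).
  rewrite -/(g h) -BE /B innerC; by case: (inner h z).
have fZ (a : C) h : f (a *: h) = a * f h.
  have f0 : f 0 = 0.
    by have := f_lin (-1) 0 0; rewrite scaler0 addr0 mulN1r addNr.
  by have := f_lin a h 0; rewrite !addr0 f0 addr0.
exists z => h; have := ReE ('i *: h); rewrite fZ linearZl_LR/= ![ 'i * _]mulrC.
rewrite -complexiE !ReiNIm => /oppr_inj ImE; have := ReE h; move: ImE.
by case: (f h) (inner h z) => [a b] [c d] /= -> ->.
Qed.

End Riesz.

Section Composition.
Context (R : realType) (H K L : hilbertType R).

Let comp_bounded (g : bop K L) (f : bop H K) :
  g \o f \in @bounded_linear R H L.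
Proof.
apply/asboolP; split; first by move=> a x y; rewrite /= !linearP.
by move=> x; apply: continuous_comp; exact: bop_continuous.
Qed.

Definition comp_bop (g : bop K L) (f : bop H K) : bop H L :=
  Bop (comp_bounded g f).

End Composition.

Section Adjoint.
Context (R : realType) (H K : hilbertType R).

Lemma inner_inj (x y : H) : (forall h, inner h x = inner h y) -> x = y.
Proof.
move=> xy; apply/eqP; rewrite -subr_eq0 -(dnorm_eq0 inner).
by rewrite linearBr/= xy subrr.
Qed.

(* Chosen by description; existence is [adjointE] below. *)
Definition adjoint (T : bop H K) : bop K H :=
  xget 0 [set S : bop K H | forall h k, inner (T h) k = inner h (S k)].

Lemma adjointE (T : bop H K) h k : inner (T h) k = inner h (adjoint T k).
Proof.
suff ex : exists S : bop K H, forall h k, inner (T h) k = inner h (S k).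
  by rewrite /adjoint; case: xgetP => [S _ ->|/forallNP/(_ _)]//;
     case: ex => S /[swap] /(_ S).
have TE : `|T| = (complex.Re `|T|)%:C by rewrite RRe_real ?normr_real.
have ex k' : exists z, forall x, inner (T x) k' = inner x z.
  have k'E : `|k'| = (complex.Re `|k'|)%:C by rewrite RRe_real ?normr_real.
  apply: (@riesz _ _ _ (complex.Re `|T| * complex.Re `|k'|)).
    by move=> a x y; rewrite linearP/= linearPl.
  move=> x; rewrite rmorphM/= -TE -k'E (le_trans (inner_CS _ _))//.
  by rewrite mulrAC ler_wpM2r// bop_normP.
have [S SE] := choice ex.
have Slin : linear S.
  move=> a x y; apply: inner_inj => h'.
  rewrite -SE linearDr/= linearZr_LR/= linearDr/= [RHS]addrC.
  by rewrite linearZr_LR/= -!SE addrC.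
have Sbnd x : `|S x| <= `|T| * `|x|.
  have [->|Sx0] := eqVneq (S x) 0; first by rewrite normr0 mulr_ge0.
  rewrite -(@ler_pM2l _ `|S x|) ?normr_gt0// -expr2 -inner_norm -SE.
  have := inner_CS (T (S x)) x; rewrite SE inner_norm normrX normr_id.
  move=> /le_trans; apply; rewrite mulrA ler_wpM2r// mulrC bop_normP//.
by exists (Bop (bounded_linearP Slin Sbnd)) => h' k'; rewrite SE.
Qed.

Definition isometry (V : bop H K) := forall h, `|V h| = `|h|.

End Adjoint.

Section OperatorMatrix.
Context (R : realType) (H : hilbertType R) (d : nat).
Implicit Types (X : 'M[bop H H]_d) (v : hpow d H).

Lemma hpow_innerE v w : inner v w = \sum_(i < d) inner (v i) (w i).
Proof. by []. Qed.

Lemma hpow_norm_ge v i : `|v i| <= `|v|.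
Proof.
rewrite -(@ler_pXn2r _ 2)// ?nnegrE// -!inner_norm hpow_innerE.
rewrite (bigD1 i)//= lerDl sumr_ge0// => j _; exact: dnorm_ge0.
Qed.

Lemma hpow_norm_le v : `|v| <= \sum_(i < d) `|v i|.
Proof.
rewrite -(@ler_pXn2r _ 2)// ?nnegrE ?sumr_ge0// -inner_norm hpow_innerE.
rewrite expr2 mulr_suml ler_sum// => i _; rewrite inner_norm expr2 ler_wpM2l//.
by rewrite (bigD1 i)//= lerDl sumr_ge0.
Qed.

Let opmx_fun X (v : hpow d H) : hpow d H := fun i => \sum_(j < d) X i j (v j).

Let opmx_linear X : linear (opmx_fun X).
Proof.
move=> a v w; apply/funext => i.
rewrite -[RHS]/(a *: opmx_fun X v i + opmx_fun X w i) /opmx_fun scaler_sumr.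
by rewrite -big_split/=; apply: eq_bigr => j _; rewrite -linearP.
Qed.

Let opmx_bound X v :
  `|opmx_fun X v| <= (\sum_(i < d) \sum_(j < d) `|X i j|) * `|v|.
Proof.
rewrite (le_trans (hpow_norm_le _))// mulr_suml ler_sum// => i _.
rewrite (le_trans (ler_norm_sum _ _ _))// mulr_suml ler_sum// => j _.
by rewrite (le_trans (bop_normP _ _))// ler_wpM2l// hpow_norm_ge.
Qed.

(* The action of a matrix over B(H) on H^d, i.e. M_d(B(H)) = B(H^d). *)
Definition opmx X : bop (hpow d H) (hpow d H) :=
  Bop (bounded_linearP (opmx_linear X) (opmx_bound X)).

End OperatorMatrix.

Definition positive_op (R : realType) (H : hilbertType R) (T : bop H H) :=
  forall h, 0 <= inner (T h) h.

Section OperatorSystem.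
Context (R : realType) (H : hilbertType R).

(* A norm-closed self-adjoint subspace of B(H); no unit is required. *)
Record opSystem := OpSystem {
  os_space :> submodClosed (bop H H);
  os_closed : closed [set` os_space];
  os_adjoint : forall x, x \in os_space -> adjoint x \in os_space
}.

Record os_elt (E : opSystem) :=
  OsElt { os_val :> bop H H; os_valP : os_val \in E }.

Context (E : opSystem).
HB.instance Definition _ := [isSub for @os_val E].
HB.instance Definition _ := [Choice of os_elt E by <:].
HB.instance Definition _ := [SubChoice_isSubLmodule of os_elt E by <:].
End OperatorSystem.

Section CompletelyPositiveContractive.
Context (R : realType) (H : hilbertType R) (E : opSystem H) (K : hilbertType R).
Implicit Types phi : os_elt E -> bop K K.

Definition completely_positive phi :=
  forall (d : nat) (X : 'M[os_elt E]_d),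
    positive_op (opmx (map_mx val X)) -> positive_op (opmx (map_mx phi X)).

Definition completely_contractive phi :=
  forall (d : nat) (X : 'M[os_elt E]_d),
    `|opmx (map_mx phi X)| <= `|opmx (map_mx val X)|.

(* QS_n(E), for K = l^2(n). *)
Definition QS : set (os_elt E -> bop K K) :=
  [set phi | [/\ linear phi, completely_positive phi &
                 completely_contractive phi]].

End CompletelyPositiveContractive.
Arguments QS {R H} E K.

Section DilationOrder.
Context (R : realType) (H : hilbertType R) (E : opSystem H).

Definition dilation_by (K L : hilbertType R) (V : bop K L)
    (phi : os_elt E -> bop K K) (psi : os_elt E -> bop L L) :=
  isometry V /\
  forall x, phi x = comp_bop (adjoint V) (comp_bop (psi x) V).

(* psi = phi (+) zeta along L = VK (+) (VK)^perp, with K identified with VK. *)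
Definition is_direct_sum (K L : hilbertType R) (V : bop K L)
    (psi : os_elt E -> bop L L) (phi : os_elt E -> bop K K)
    (zeta : os_elt E -> bop (ocompl (range V)) (ocompl (range V))) :=
  forall x (h : K) (k : ocompl (range V)),
    psi x (V h + val k) = V (phi x h) + val (zeta x k).

Arguments is_direct_sum {K L} V psi phi zeta.

Definition dilation_maximal (K : hilbertType R) (phi : os_elt E -> bop K K) :=
  forall (L : hilbertType R) (psi : os_elt E -> bop L L) (V : bop K L),
    QS E L psi -> dilation_by V phi psi ->
    exists2 zeta, QS E (ocompl (range V)) zeta & is_direct_sum V psi phi zeta.

End DilationOrder.

Definition extreme_point (R : realType) (V : lmodType R[i]) (A : set V) (x : V) :=
  A x /\ forall (y z : V) (t : R), A y -> A z -> 0 < t < 1 ->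
    x = t%:C *: y + (1 - t)%:C *: z -> y = x /\ z = x.

(* K plays the role of l^2(n); every nonzero Hilbert space is of this form. *)
Definition extremal_point (R : realType) (H : hilbertType R) (E : opSystem H)
    (K : hilbertType R) (phi : os_elt E -> bop K K) :=
  extreme_point (QS E K) phi /\ dilation_maximal phi.

Definition delta0 (R : realType) (H : hilbertType R) (E : opSystem H)
    : os_elt E -> bop (hilbC R) (hilbC R) := fun=> 0.
Arguments delta0 {R H} E _.

Definition lspan (R : realType) (V : lmodType R[i]) (A : set V) : set V :=
  [set x | exists (n : nat) (c : 'I_n -> R[i]) (a : 'I_n -> V),
     (forall i, A (a i)) /\ x = \sum_(i < n) c i *: a i].

Definition positive_cone (R : realType) (H : hilbertType R) (E : opSystem H)
    : set (bop H H) :=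
  [set x | x \in os_space E /\ positive_op x].

Definition approx_generated_by_positives (R : realType) (H : hilbertType R)
    (E : opSystem H) :=
  closure (lspan (positive_cone E)) = [set` os_space E].

(* Main.v *)
(* If some x in E lies outside the closed span of E_+, Hahn-Banach yields a
   contractive functional phi that vanishes on E_+ but not at x. For a positive
   matrix X over E the element w^* X w lies in E_+, so phi and - phi are both
   completely positive, and 0 is the midpoint of these two distinct points of
   QS_1(E).

   Conversely, let E be the closed span of E_+. Points of QS_1(E) averaging to 0
   vanish on E_+, hence on E. If psi dilates 0 through V, then
   <psi(x) V h, V h> = 0, so for x >= 0 positivity gives psi(x) V h = 0 and
   <psi(x) k, V h> = 0 for all k; both extend to E by density, so that psi is
   the direct sum of 0 and its restriction to the complement of the range of V. *)
Require Import Defs.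
From HB Require Import structures.
From mathcomp Require Import all_boot all_order all_algebra.
From mathcomp Require Import all_classical all_reals.
From mathcomp Require Import topology normedtype.
From mathcomp Require Import sesquilinear complex ring lra.

Set Implicit Arguments.
Unset Strict Implicit.
Unset Printing Implicit Defensive.

Import Order.TTheory GRing.Theory Num.Theory.
Import numFieldNormedType.Exports.

Local Open Scope classical_set_scope.
Local Open Scope complex_scope.
Local Open Scope ring_scope.

(** * The real Hahn-Banach theorem with a sublinear bound *)

Section HahnBanach.
Context (R : realType) (V : lmodType R) (p : V -> R).
Hypotheses (pD : forall x y, p (x + y) <= p x + p y)
  (pZ : forall (t : R) x, 0 <= t -> p (t *: x) = t * p x).

(* Domination by p makes such a set single-valued: if (0, r) belongs to it,
   then r <= p 0 = 0 and - r <= 0. *)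
Let dominated_graph (A : set (V * R)) :=
  (forall (t : R) u v, A u -> A v -> A (t *: u.1 + v.1, t * u.2 + v.2)) /\
  (forall u, A u -> u.2 <= p u.1).

Let graph_scale A (t : R) u : dominated_graph A -> A u -> A (t *: u.1, t * u.2).
Proof.
move=> [Alin _] Au; have A0 := Alin (-1) u u Au Au.
have := Alin t _ _ Au A0; rewrite /= scaleN1r addNr mulN1r addNr !addr0.
by [].
Qed.

(** For [u] and [w] in [A], [w.2 + u.2 <= p (u.1 + v) + p (w.1 - v)], so each lower bound
    [w.2 - p (w.1 - v)] for the value at [v] is at most each upper bound [p (u.1 + v) - u.2]. The
    supremum of the lower bounds is an admissible [s]. *)
Let dominated_graph_extend A v : dominated_graph A -> A !=set0 ->
  exists s : R, dominated_graph
    [set w | exists u (t : R), A u /\ w = (u.1 + t *: v, u.2 + t * s)].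
Proof.
move=> gA [u0 Au0]; have [Alin Ap] := gA.
pose S := [set u.2 - p (u.1 - v) | u in A].
have Sub u : A u -> ubound S (p (u.1 + v) - u.2).
  move=> Au _ [w Aw <-]; rewrite lerBlDr addrAC lerBrDr.
  have := Ap _ (Alin 1 _ _ Aw Au); rewrite /= scale1r mul1r => /le_trans; apply.
  rewrite (_ : w.1 + u.1 = (u.1 + v) + (w.1 - v)) ?pD//.
  by rewrite addrACA subrr addr0 addrC.
have S0 : S !=set0 by exists (u0.2 - p (u0.1 - v)), u0.
exists (sup S); set s := sup S.
have sP u : A u -> u.2 + s <= p (u.1 + v).
  by move=> Au; rewrite addrC -lerBrDr ge_sup//; exact: Sub.
have sN u : A u -> u.2 - s <= p (u.1 - v).
  move=> Au; rewrite lerBlDr addrC -lerBlDr ub_le_sup//.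
    by exists (p (u.1 + v) - u.2); exact: Sub.
  by exists u.
split=> [t _ _ [u [a [Au ->]]] [w [b [Aw ->]]]|_ [u [t [Au ->]]]]/=.
  exists (t *: u.1 + w.1, t * u.2 + w.2), (t * a + b); split; first exact: Alin.
  congr (_, _) => /=; last by ring.
  by rewrite scalerDr scalerDl scalerA addrACA.
(* Dividing by the absolute value of [t] reduces to the coefficients -1 and 1, that is, to [sN] and
   [sP]. *)
have [t0|t0|->] := ltgtP t 0; last by rewrite scale0r mul0r !addr0 Ap.
- have nt : 0 < - t by rewrite oppr_gt0.
  have := sN _ (graph_scale (- t)^-1 gA Au).
  rewrite -(ler_pM2l nt)/= -pZ ?(ltW nt)//.
  rewrite mulrBr mulrA divff ?gt_eqF// mul1r scalerBr scalerA divff ?gt_eqF//.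
  by rewrite scale1r scaleNr mulNr !opprK.
- have := sP _ (graph_scale t^-1 gA Au).
  rewrite -(ler_pM2l t0)/= -pZ ?(ltW t0)//.
  by rewrite mulrDr mulrA divff ?gt_eqF// mul1r scalerDr scalerA divff ?gt_eqF// scale1r.
Qed.

(** Partial functionals are encoded by their graphs, so that Zorn's lemma applies to sets ordered by
    inclusion, with unions as upper bounds of chains. *)
Lemma hahn_banach (G : set (V * R)) : G !=set0 ->
  (forall (t : R) u v, G u -> G v -> G (t *: u.1 + v.1, t * u.2 + v.2)) ->
  (forall u, G u -> u.2 <= p u.1) ->
  exists f : V -> R, [/\ scalar f, forall x, f x <= p x &
                         forall u, G u -> f u.1 = u.2].
Proof.
move=> G0 Glin Gp.
(* The empty chain has an empty union, so only a nonempty [A] can be required to contain [G]. *)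
pose P A := dominated_graph A /\ (A !=set0 -> G `<=` A).
have [A [[gA GA] maxA]] : exists A, P A /\ forall B, A `<` B -> ~ P B.
  apply: Zorn_bigcup => F FP Ftot; split; last first.
    by move=> [u [A FA Au]] w Gw; exists A => //; apply: (FP _ FA).2 Gw; exists u.
  split=> [t u v [A FA Au] [B FB Bv]|u [A FA Au]]; last exact: (FP _ FA).1.2.
  have [AB|BA] := Ftot _ _ FA FB.
    by exists B => //; apply: (FP _ FB).1.1 => //; exact: AB.
  by exists A => //; apply: (FP _ FA).1.1 => //; exact: BA.
have {maxA} maxA B : P B -> A `<=` B -> B `<=` A.
  by move=> PB AB; apply: contrapT => BA; exact: (maxA B).
have A0 : A !=set0.
  apply: contrapT => A0; case: G0 => u Gu; apply: (A0); exists u.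
  apply: (maxA G _ _ u Gu) => [|w Aw]; last by case: A0; exists w.
  by split=> [|_]; [split|exact: subset_refl].
have [Alin Ap] := gA.
have Atot v : exists r, A (v, r).
  have [s gB] := dominated_graph_extend v gA A0; set B := [set w | _] in gB.
  have AB : A `<=` B.
    by move=> u Au; exists u, 0; rewrite scale0r mul0r !addr0; case: u Au.
  exists s; apply: (maxA B) => //; first by split=> // _; exact: subset_trans (GA A0) AB.
  have [u Au] := A0; exists (0 *: u.1, 0 * u.2), 1; split; first exact: graph_scale.
  by rewrite scale0r mul0r scale1r mul1r !add0r.
have Auniq v r s : A (v, r) -> A (v, s) -> r = s.
  move=> Ar As.
  have := Ap _ (Alin (-1) _ _ Ar As); have := Ap _ (Alin (-1) _ _ As Ar).
  have p0 : p 0 = 0 by have := pZ 0 (lexx 0); rewrite scaler0 mul0r.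
  by rewrite /= scaleN1r addNr p0; lra.
have [f fA] := choice Atot; exists f; split=> [t x y|x|u Gu].
- by apply: Auniq (fA _) (Alin t (x, _) (y, _) (fA x) (fA y)).
- exact: Ap (fA x).
- by apply: Auniq (fA _) _; rewrite -surjective_pairing; exact: GA.
Qed.

End HahnBanach.

(** * Complex vector spaces with real scalars *)

Section RestrictionOfScalars.
Context (R : realType) (V : lmodType R[i]).

(** A separate name keeps the real scaling apart from the complex one on [V]. *)
Definition realified (W : Type) := W.
HB.instance Definition _ := GRing.Zmodule.copy (realified V) V.

Let rscale (t : R) (x : realified V) : realified V := t%:C *: (x : V).

Let rscaleA a b x : rscale a (rscale b x) = rscale (a * b) x.
Proof. by rewrite /rscale scalerA rmorphM. Qed.
Let rscale1 : left_id 1 rscale.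
Proof. by move=> x; rewrite /rscale scale1r. Qed.
Let rscaleDr : right_distributive rscale +%R.
Proof. by move=> t x y; rewrite /rscale scalerDr. Qed.
Let rscaleDl x : {morph rscale^~ x : a b / a + b}.
Proof. by move=> a b; rewrite /rscale rmorphD scalerDl. Qed.

HB.instance Definition _ := GRing.Zmodule_isLmodule.Build R (realified V)
  rscaleA rscale1 rscaleDr rscaleDl.

End RestrictionOfScalars.

(** * Separation of a point from the closure of a complex subspace *)

Section Separation.
Context (R : realType) (V : normedModType R[i]).
Local Notation C := R[i].

Let p (x : realified V) : R := complex.Re `|x : V|.

Let pE x : `|x : V| = (p x)%:C.
Proof. by rewrite /p RRe_real// normr_real. Qed.

(** Let [d > 0] bound the distance from [x0] to [F] from below. The functional [z + t x0 |-> t d] on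
    [F + R x0] is dominated by the norm; it extends to a real functional, which is then
    complexified. *)
Lemma separating_functional (F : set V) (x0 : V) : F 0 ->
  (forall (c : C) x y, F x -> F y -> F (c *: x + y)) -> ~ closure F x0 ->
  exists phi : V -> C, [/\ scalar phi, forall x, `|phi x| <= `|x|,
    forall x, F x -> phi x = 0 & phi x0 != 0].
Proof.
move=> F0 Flin Fx0.
have nC (t : R) : `|t%:C : C| = `|t|%:C.
  by rewrite normc_def/= expr0n/= addr0 sqrtr_sqr.
have [d d0 dF] : exists2 d : R, 0 < d & forall z, F z -> d%:C <= `|x0 + z|.
  apply: contrapT => nd; apply: Fx0 => B /nbhs_ballP[e /= e0 eB].
  apply: contrapT => FB; apply: nd; exists (complex.Re e).
    by rewrite -ltcR RRe_real ?gtr0_real.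
  move=> z Fz; rewrite RRe_real ?gtr0_real// real_leNgt ?normr_real ?gtr0_real//.
  apply/negP => x0z; apply: FB; exists (- z); split.
    by rewrite -[- z]addr0 -scaleN1r; exact: Flin.
  by apply: eB; rewrite -ball_normE/= opprK.
pose G : set (realified V * R) :=
  [set u | exists z t, F z /\ u = (z + t%:C *: x0, t * d)].
have [|||||f [flin fp fG]] := @hahn_banach R (realified V) p _ _ G.
- by move=> x y; rewrite -lecR rmorphD/= -!pE ler_normD.
- move=> t x t0; apply: complexI; rewrite rmorphM/= -!pE normrZ.
  by rewrite ger0_norm// ler0c.
- by exists (0, 0), 0, 0; rewrite scale0r mul0r addr0.
- move=> t _ _ [z [a [Fz ->]]] [w [b [Fw ->]]] /=.
  exists (t%:C *: z + w), (t * a + b); split; first exact: Flin.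
  congr (_, _); last by ring.
  rewrite -[_ *: _]/(t%:C *: _) scalerDr rmorphD rmorphM scalerDl scalerA.
  by rewrite addrACA.
- move=> _ [z [t [Fz ->]]] /=; rewrite -lecR -pE.
  have [->|t0] := eqVneq t 0; first by rewrite mul0r normr_ge0.
  have tC : t%:C != 0 :> C by rewrite fmorph_eq0.
  have -> : z + t%:C *: x0 = t%:C *: (x0 + t%:C^-1 *: z).
    by rewrite scalerDr scalerA divff// scale1r addrC.
  have Fz' : F (t%:C^-1 *: z) by rewrite -[_ *: z]addr0; exact: Flin.
  rewrite normrZ (@le_trans _ _ (`|t%:C| * d%:C))//; last first.
    by rewrite ler_wpM2l// dF.
  by rewrite nC -rmorphM lecR ler_wpM2r ?ler_norm// ltW.
have fD x y : f (x + y) = f x + f y.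
  by have := flin 1 x y; rewrite scale1r mul1r.
have fZ (t : R) (x : V) : f (t%:C *: x) = t * f x.
  have f0 : f 0 = 0 by have := fD 0 0; rewrite addr0; lra.
  by have := flin t x 0; rewrite !addr0 f0 addr0.
have fle (x : V) : `|(f x)%:C : C| <= `|x|.
  rewrite nC pE lecR ler_norml fp andbT.
  have := fp (- x); rewrite /p normrN -scaleN1r.
  have -> : (-1 : C) = (-1)%:C by rewrite rmorphN.
  by rewrite fZ; lra.
(* This is [f x - i f (i x)]. The triangle inequality bounds it by [2 |x|], hence the factor 1/2
   below, which does not affect nonvanishing at [x0]. *)
pose g (x : V) : C := f x +i* - f ('i *: x).
exists (fun x => 2^-1 * g x); split.
- have gD x y : g (x + y) = g x + g y by rewrite /g scalerDr !fD opprD.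
  have gZ (c : C) x : g (c *: x) = c * g x.
    case: c => a b; rewrite /g.
    have -> : (a +i* b)%C *: x = a%:C *: x + b%:C *: ('i *: x).
      rewrite scalerA -scalerDl; congr (_ *: _).
      by rewrite [LHS]complexE/= [b%:C * _]mulrC.
    have -> : 'i *: (a%:C *: x + b%:C *: ('i *: x)) =
              a%:C *: ('i *: x) + (- b)%:C *: x.
      rewrite scalerDr !scalerA; congr (_ *: _ + _ *: _); first exact: mulrC.
      by rewrite mulrAC -expr2 sqrCi mulN1r rmorphN.
    by rewrite !fD !fZ; simpc; congr (_ +i* _)%C; ring.
  by move=> c x y; rewrite gD gZ; ring.
- move=> x; rewrite normrM normfV normr_nat ler_pdivrMl ?ltr0n// mulr_natl.
  rewrite mulr2n.
  have -> : g x = (f x)%:C - 'i * (f ('i *: x))%:C.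
    by rewrite /g [LHS]complexE/= rmorphN mulrN.
  rewrite (le_trans (ler_normB _ _))// normrM normCi mul1r lerD//.
  by rewrite (le_trans (fle _))// normrZ normCi mul1r.
- move=> x Fx.
  have f0 y : F y -> f y = 0.
    by move=> Fy; apply: (fG (y, 0)); exists y, 0; rewrite scale0r mul0r addr0.
  rewrite /g !f0 ?oppr0 ?mulr0//.
  by rewrite -['i *: x]addr0; exact: Flin.
- have -> : g x0 = d +i* - f ('i *: x0).
    congr (_ +i* _)%C; apply: (fG (x0, d)); exists 0, 1.
    by rewrite scale1r mul1r add0r.
  rewrite mulf_neq0 ?invr_eq0 ?pnatr_eq0//.
  by rewrite eq_complex/= negb_and gt_eqF.
Qed.

End Separation.

(** * Norms and forms of operators and operator matrices *)

Lemma bop_norm_le (R : realType) (H K : hilbertType R) (T : bop H K) (M : R[i]) :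
  0 <= M -> (forall x, `|T x| <= M * `|x|) -> `|T| <= M.
Proof.
move=> M0 TM; have ME : M = (complex.Re M)%:C by rewrite RRe_real ?ger0_real.
rewrite bop_normE ME lecR; apply: ge_sup.
  by exists (complex.Re `|T 0|), 0; rewrite //= normr0 ler01.
move=> _ [x /= x1 <-]; rewrite -lecR -ME RRe_real ?normr_real//.
by rewrite (le_trans (TM x))// ler_piMr.
Qed.

Section MatrixNorm.
Context (R : realType) (H : hilbertType R) (d : nat).
Implicit Types (X : 'M[bop H H]_d) (v : hpow d H).

(** Two different spaces are allowed, to cover both tensors with a fixed vector and the inclusion of
    a subspace. *)
Lemma hpow_norm_eq (K L : hilbertType R) (v : hpow d K) (w : hpow d L) (c : R[i]) :
  0 <= c -> (forall i, `|v i| = c * `|w i|) -> `|v| = c * `|w|.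
Proof.
move=> c0 vw; apply/eqP; rewrite -(@eqrXn2 _ 2)// ?mulr_ge0//.
rewrite exprMn -!inner_norm !hpow_innerE mulr_sumr; apply/eqP/eq_bigr => i _.
by rewrite !inner_norm vw exprMn.
Qed.

Lemma inner_opmx X v (w : hpow d H) :
  inner (opmx X v) w = \sum_(i < d) \sum_(j < d) inner (X i j (v j)) (w i).
Proof. by rewrite hpow_innerE; apply: eq_bigr => i _; rewrite linear_sumlz. Qed.

End MatrixNorm.

Lemma hilbC_normE (R : realType) (z : hilbC R) : `|z| = `|z : R[i]|.
Proof. by rewrite -sqrt_inner -[inner z z]/((z : R[i]) * (z : R[i])^*) -normCK sqrCK. Qed.

(** * Functionals vanishing on the positive cone as points of QS_1(E) *)

Section ScalarMaps.
Context (R : realType) (H : hilbertType R) (E : opSystem H).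
Local Notation C := R[i].

Let mulop_linear (c : C) : linear (fun z : hilbC R => c *: z).
Proof. by move=> a x y; rewrite scalerDr !scalerA mulrC. Qed.

Let mulop_bounded (c : C) (z : hilbC R) : `|c *: z| <= `|c| * `|z|.
Proof. by rewrite normrZ. Qed.

Definition mul_bop (c : C) : bop (hilbC R) (hilbC R) :=
  Bop (bounded_linearP (mulop_linear c) (mulop_bounded c)).

(* [compress X v w] is w^* X v, and <w^* X v k, l> = <X (v (x) k), w (x) l>. *)
Let compress d (X : 'M[bop H H]_d) (v w : hpow d (hilbC R)) : bop H H :=
  \sum_(i < d) \sum_(j < d) ((w i : C)^* * (v j : C)) *: X i j.

Let tensor d (v : hpow d (hilbC R)) (k : H) : hpow d H := fun i => (v i : C) *: k.

Let bop_sum (I : finType) (T : I -> bop H H) k : (\sum_i T i) k = \sum_i T i k.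
Proof. exact: (big_morph (fun S : bop H H => S k)). Qed.

Let tensor_norm d (v : hpow d (hilbC R)) (k : H) : `|tensor v k| = `|k| * `|v|.
Proof. by apply: hpow_norm_eq => // i; rewrite normrZ mulrC hilbC_normE. Qed.

Let inner_compress d (X : 'M[bop H H]_d) v w k l :
  inner (compress X v w k) l = inner (opmx X (tensor v k)) (tensor w l).
Proof.
rewrite inner_opmx /compress bop_sum linear_sumlz; apply: eq_bigr => i _.
rewrite bop_sum linear_sumlz; apply: eq_bigr => j _.
rewrite /tensor [X i j (_ *: _)]linearZ/= linearZr_LR/= !linearZl_LR/=.
by rewrite mulrA.
Qed.

(** With [l = w^* X v k], the square of [|l|] is [<X (v (x) k), w (x) l>], which Cauchy-Schwarz
    bounds by [|X| |v| |k| |w| |l|]; then divide by [|l|]. *)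
Let compress_norm d (X : 'M[bop H H]_d) v w :
  `|compress X v w| <= `|opmx X| * `|v| * `|w|.
Proof.
apply: bop_norm_le; first by rewrite !mulr_ge0.
move=> k; set l := compress X v w k.
have [->|l0] := eqVneq l 0; first by rewrite normr0 !mulr_ge0.
rewrite -(@ler_pM2r _ `|l|) ?normr_gt0// -expr2 -inner_norm {1}/l.
rewrite inner_compress -[leLHS]ger0_norm; last by rewrite -inner_compress inner_norm exprn_ge0.
rewrite (le_trans (inner_CS _ _))// tensor_norm.
have := ler_wpM2r (mulr_ge0 (normr_ge0 l) (normr_ge0 w))
  (bop_normP (opmx X) (tensor v k)).
move=> /le_trans; apply; rewrite tensor_norm.
by rewrite le_eqVlt; apply/orP; left; apply/eqP; ring.
Qed.

Context (phi : bop H H -> C).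
Hypotheses (phi_lin : scalar phi) (phi_le : forall x, `|phi x| <= `|x|)
  (phi0 : forall x, positive_cone E x -> phi x = 0).

Definition scalar_map (x : os_elt E) : bop (hilbC R) (hilbC R) :=
  mul_bop (phi (val x)).

(** Compressions turn questions about every matrix size into questions about [phi] on single
    operators. *)
Let inner_scalar_map d (X : 'M[os_elt E]_d) v w :
  inner (opmx (map_mx scalar_map X) v) w = phi (compress (map_mx val X) v w).
Proof.
pose phi' : {scalar bop H H} :=
  HB.pack phi (GRing.isLinear.Build C (bop H H) C *%R phi phi_lin).
rewrite inner_opmx -[phi]/(phi' : _ -> _) /compress linear_sum; apply: eq_bigr => i _.
rewrite linear_sum; apply: eq_bigr => j _; rewrite linearZ !mxE /=.
rewrite -[LHS]/((phi (val (X i j)) * (v j : C)) * (w i : C)^*).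
by ring.
Qed.

Lemma scalar_map_QS : QS E (hilbC R) scalar_map.
Proof.
split=> [a x y|d X X0 v|d X].
- apply/val_inj/funext => z /=.
  rewrite -[LHS]/(phi (a *: val x + val y) * (z : C)) phi_lin mulrDl.
  by rewrite -mulrA.
- rewrite inner_scalar_map phi0//; split.
    by apply: rpred_sum => i _; apply: rpred_sum => j _; rewrite mxE rpredZ// os_valP.
  by move=> k; rewrite inner_compress.
(* Testing against the image [w] of [v] turns the form into [|w|^2], which [compress_norm] bounds by
   [|X| |v| |w|]. *)
- apply: bop_norm_le => // v; set w := opmx _ v.
  have [->|w0] := eqVneq w 0; first by rewrite normr0 mulr_ge0.
  rewrite -(@ler_pM2r _ `|w|) ?normr_gt0// -expr2 -inner_norm {1}/w.
  rewrite -[leLHS]ger0_norm; last by rewrite inner_norm exprn_ge0.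
  by rewrite inner_scalar_map (le_trans (phi_le _))// compress_norm.
Qed.

End ScalarMaps.

(** * Linear spans, and extremality implies generation *)

Section Generation.
Context (R : realType) (H : hilbertType R) (E : opSystem H).
Local Notation C := R[i].

Lemma lspan0 (V : lmodType C) (A : set V) : lspan A 0.
Proof. by exists 0, (fun=> 0), (fun=> 0); split=> [[]//|]; rewrite big_ord0. Qed.

Lemma lspan_linear (V : lmodType C) (A : set V) (c : C) x y :
  lspan A x -> lspan A y -> lspan A (c *: x + y).
Proof.
move=> [m [a [x_ [Ax ->]]]] [n [b [y_ [Ay ->]]]].
exists (m + n)%N,
  (fun k => match fintype.split k with inl i => c * a i | inr j => b j end),
  (fun k => match fintype.split k with inl i => x_ i | inr j => y_ j end); split.
  by move=> k; case: fintype.split.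
rewrite big_split_ord/= scaler_sumr; congr (_ + _); apply: eq_bigr => i _.
  by rewrite (unsplitK (inl i)) scalerA.
by rewrite (unsplitK (inr i)).
Qed.

Lemma sub_lspan (V : lmodType C) (A : set V) : A `<=` lspan A.
Proof.
move=> x Ax; exists 1, (fun=> 1), (fun=> x); split=> //.
by rewrite big_ord1 scale1r.
Qed.

Lemma closure_lspan_positive_sub :
  closure (lspan (positive_cone E)) `<=` [set` os_space E].
Proof.
rewrite [X in _ `<=` X](closure_id _).1; last exact: os_closed.
apply: closureS => _ [n [c [a [aE ->]]]] /=.
by apply: rpred_sum => i _; rewrite rpredZ//; case: (aE i).
Qed.

Lemma extremal_generated :
  extremal_point (delta0 E) -> approx_generated_by_positives E.
Proof.
move=> [[_ ext] _]; apply/seteqP; split; first exact: closure_lspan_positive_sub.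
move=> x xE; apply: contrapT => xN.
have [phi [phi_lin phi_le phi0 phix]] :=
  separating_functional (lspan0 _) (@lspan_linear _ _) xN.
have phi_cone y : positive_cone E y -> phi y = 0.
  by move=> Ey; apply: phi0; exact: sub_lspan.
pose psi y := - phi y.
have psi_lin : scalar psi by move=> a y z; rewrite /psi phi_lin mulrN opprD.
have psi_le y : `|psi y| <= `|y| by rewrite normrN.
have psi_cone y : positive_cone E y -> psi y = 0.
  by move=> Ey; rewrite /psi phi_cone// oppr0.
have [||E0 _] := ext _ _ 2^-1 (scalar_map_QS phi_lin phi_le phi_cone)
  (scalar_map_QS psi_lin psi_le psi_cone).
- by apply/andP; split; lra.
- apply/funext => y; apply/val_inj/funext => z.
  rewrite -[LHS]/(0 : C).
  rewrite -[RHS]/(2^-1%:C * (phi (val y) * (z : C)) +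
                  (1 - 2^-1)%:C * (- phi (val y) * (z : C))).
  have -> : (1 - 2^-1 : R) = 2^-1 by lra.
  by ring.
(* Evaluating at [x] and then at the scalar 1 recovers [phi x]. *)
have := congr1 (fun f : os_elt E -> bop (hilbC R) (hilbC R) => f (OsElt xE) 1) E0.
rewrite -[LHS]/(phi x * 1) mulr1 => phix0.
by move: phix; rewrite phix0 eqxx.
Qed.

End Generation.

(** * Vectors on which a positive form vanishes *)

Section PositiveOperators.
Context (R : realType) (K : hilbertType R).
Local Notation C := R[i].

(* For positive T the form <T(h + c v), h + c v> is nonnegative; when <T v, v>
   vanishes it is real affine in c, so its linear part is zero. *)
Lemma positive_op_kernel (T : bop K K) (v : K) : positive_op T ->
  inner (T v) v = 0 -> T v = 0 /\ forall h, inner (T h) v = 0.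
Proof.
move=> T0 Tv.
have lin (c : C) h : c * inner (T v) h + c^* * inner (T h) v = 0.
  have E (t : R) : 0 <= inner (T h) h + t%:C * (c * inner (T v) h + c^* * inner (T h) v).
    have := T0 (h + (t%:C * c) *: v).
    rewrite [T _]linearD linearZ linearDl/= !linearDr/= !linearZr_LR/= !linearZl_LR/=.
    rewrite Tv !mulr0 addr0 rmorphM/= conj_Creal ?complex_real//.
    by congr (_ <= _); ring.
  move: (_ + _) E => b E.
  have a0 : 0 <= inner (T h) h by have := E 0; rewrite mul0r addr0.
  have bR : b \is Num.real.
    have := E 1; rewrite mul1r => /ger0_real.
    by rewrite rpredDl// ger0_real.
  apply/eqP/negPn/negP => b0.
  (* For nonzero [b], this real [t] makes the nonnegative expression in [E] equal to -1. *)
  have /complex_realP[t tE] : - (inner (T h) h + 1) / b \is Num.real.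
    by rewrite rpredM ?rpredV// rpredN rpredD ?rpred1// ger0_real.
  have := E t; rewrite -tE divfK// opprD addrA subrr sub0r.
  by rewrite oppr_ge0 ler10.
have Tvh h : inner (T v) h = 0 /\ inner (T h) v = 0.
  (* The values 1 and i of [c] show that the two inner products have zero sum and zero
     difference. *)
  have := lin 1 h; have := lin 'i h.
  rewrite conjC1 conjCi !mul1r mulNr -mulrBr => /eqP.
  rewrite mulf_eq0 (negPf (neq0Ci _))/= subr_eq0 => /eqP <- /eqP.
  by rewrite -mulr2n mulrn_eq0/= => /eqP ->.
split=> [|h]; last by case: (Tvh h).
by apply/eqP; rewrite -(dnorm_eq0 inner) (Tvh _).1.
Qed.

End PositiveOperators.

(** * Positivity and contractivity at matrix size one *)

Section QSTheory.
Context (R : realType) (H : hilbertType R) (E : opSystem H) (K : hilbertType R).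
Context (psi : os_elt E -> bop K K) (psiQS : QS E K psi).

Let opmx1 (L : hilbertType R) (T : bop L L) (v : hpow 1 L) i :
  opmx (const_mx T) v i = T (v ord0).
Proof. by rewrite /= big_ord1 mxE. Qed.

(** [hpow 1 L] is isometric to [L] through its only coordinate. *)
Let norm_opmx1 (L : hilbertType R) (T : bop L L) : `|opmx (const_mx T : 'M_1)| = `|T|.
Proof.
have h1 (v : hpow 1 L) : `|v| = `|v ord0|.
  apply/le_anti; rewrite hpow_norm_ge andbT.
  by rewrite (le_trans (hpow_norm_le _))// big_ord1.
apply/le_anti/andP; split; apply: bop_norm_le => // v.
  by rewrite !h1 opmx1 bop_normP.
have := bop_normP (opmx (const_mx T : 'M_1)) ((fun=> v) : hpow 1 L).
by rewrite !h1 opmx1.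
Qed.

Lemma QS_norm x : `|psi x| <= `|val x|.
Proof.
have [_ _ cc] := psiQS; rewrite -norm_opmx1 -[leRHS]norm_opmx1.
by have := cc 1 (const_mx x); rewrite !map_const_mx.
Qed.

Lemma QS_positive x : positive_op (val x) -> positive_op (psi x).
Proof.
have [_ cp _] := psiQS => x0 h.
have := cp 1 (const_mx x); rewrite !map_const_mx => /(_ _ (fun=> h)).
rewrite hpow_innerE big_ord1 opmx1; apply => v.
by rewrite hpow_innerE big_ord1 opmx1.
Qed.

End QSTheory.

(** * Extension of identities from the positives by density *)

Section Density.
Context (R : realType) (H : hilbertType R) (E : opSystem H).
Local Notation C := R[i].
Hypothesis Egen : approx_generated_by_positives E.

(** The bound in terms of [val] stands for continuity: it carries the vanishing from the span of the
    positives to its closure. *)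
Lemma vanish_on_positives (W : normedModType C) (L : os_elt E -> W) (M : C) :
  linear L -> 0 <= M -> (forall x, `|L x| <= M * `|val x|) ->
  (forall x, positive_op (val x) -> L x = 0) -> forall x, L x = 0.
Proof.
move=> Llin M0 LM L0 x.
pose L' : {linear os_elt E -> W} :=
  HB.pack L (GRing.isLinear.Build C (os_elt E) W *:%R L Llin).
apply/eqP; rewrite -normr_le0; apply/ler_addgt0Pr => e e0; rewrite add0r.
(* Adding 1 to [M] avoids division by zero and still gives [M * (e / (M + 1)) <= e]. *)
have e'0 : 0 < e / (M + 1) by rewrite divr_gt0// ltr_wpDl.
have : closure (lspan (positive_cone E)) (val x) by rewrite Egen; exact: os_valP.
move=> /(_ _ (nbhsx_ballx _ _ e'0))[_ [[n [c [a [aE ->]]]]]].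
pose b i : os_elt E := OsElt (aE i).1.
have -> : \sum_(i < n) c i *: a i = val (\sum_(i < n) c i *: b i).
  by rewrite linear_sum; apply: eq_bigr => i _; rewrite linearZ.
have b0 : L (\sum_(i < n) c i *: b i) = 0.
  rewrite -[L]/(L' : _ -> _) linear_sum big1// => i _.
  by rewrite linearZ/= L0 ?scaler0//; exact: (aE i).2.
rewrite -ball_normE/= => xb.
have -> : L x = L (x - \sum_(i < n) c i *: b i).
  by rewrite -[L]/(L' : _ -> _) linearB/= b0 subr0.
rewrite (le_trans (LM _))// (@le_trans _ _ (M * (e / (M + 1))))//.
  by rewrite ler_wpM2l// ltW.
by rewrite mulrA ler_pdivrMr ?ltr_wpDl// mulrC ler_pM2l// lerDl.
Qed.

End Density.

(** * Restriction to the orthogonal complement of the range of V *)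

Section Compression.
Context (R : realType) (H : hilbertType R) (E : opSystem H).
Context (K L : hilbertType R) (V : bop K L) (psi : os_elt E -> bop L L).
Hypotheses (psiQS : QS E L psi)
  (psiV : forall x k h, inner (psi x k) (V h) = 0).

Let D := ocompl (range V).

Let psi_ocompl x (k : D) : psi x k \in orthogonal_to (range V).
Proof. by apply/asboolP => _ [h _ <-]. Qed.

Let zeta_fun x (k : D) : D := Ocompl (psi_ocompl x k).

Let zeta_linear x : linear (zeta_fun x).
Proof. by move=> a k l; apply: val_inj => /=; rewrite linearP. Qed.

Let ocompl_norm (k : D) : `|k| = `|val k|.
Proof. by rewrite -!sqrt_inner. Qed.

Let zeta_bound x k : `|zeta_fun x k| <= `|psi x| * `|k|.
Proof. by rewrite !ocompl_norm bop_normP. Qed.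

(** By [psiV] the whole range of [psi x] lies in the complement, so [psi x] restricts without a
    projection. *)
Definition ocompl_restriction x : bop D D :=
  Bop (bounded_linearP (zeta_linear x) (zeta_bound x)).

Let hval d (v : hpow d D) : hpow d L := fun i => val (v i).

Let hval_norm d (v : hpow d D) : `|v| = `|hval v|.
Proof. by rewrite -[RHS]mul1r; apply: hpow_norm_eq => // i; rewrite mul1r ocompl_norm. Qed.

Let val_sum (I : finType) (F : I -> D) : val (\sum_i F i) = \sum_i val (F i).
Proof. exact: raddf_sum. Qed.

Let hval_opmx d (X : 'M[os_elt E]_d) v :
  hval (opmx (map_mx ocompl_restriction X) v) = opmx (map_mx psi X) (hval v).
Proof.
apply/funext => i; rewrite /hval /= val_sum; apply: eq_bigr => j _.
by rewrite !mxE.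
Qed.

(** The inclusion of [D^d] into [L^d] is isometric and intertwines the amplifications, so positivity
    and norm bounds pass from [psi] to the restriction. *)
Lemma ocompl_restriction_QS : QS E D ocompl_restriction.
Proof.
have [psi_lin psi_cp psi_cc] := psiQS; split=> [a x y|d X X0 v|d X].
- apply/val_inj/funext => k; apply: val_inj.
  by rewrite /= psi_lin.
- have := psi_cp d X X0 (hval v); rewrite -hval_opmx.
  by rewrite !hpow_innerE.
- apply: bop_norm_le => // v; rewrite !hval_norm hval_opmx.
  by rewrite (le_trans (bop_normP _ _))// ler_wpM2r.
Qed.

End Compression.

(** * Generation implies extremality *)

Section Extremality.
Context (R : realType) (H : hilbertType R) (E : opSystem H).
Local Notation C := R[i].
Hypothesis Egen : approx_generated_by_positives E.

Let delta0_QS : QS E (hilbC R) (delta0 E).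
Proof.
have d0 d (X : 'M[os_elt E]_d) v : opmx (map_mx (delta0 E) X) v = 0.
  by apply/funext => i; rewrite /= big1// => j _; rewrite mxE.
split=> [a x y|d X _ v|d X]; first by rewrite scaler0 addr0.
  by rewrite d0 linear0l.
by apply: bop_norm_le => // v; rewrite d0 normr0 mulr_ge0.
Qed.

Lemma delta0_extreme : extreme_point (QS E (hilbC R)) (delta0 E).
Proof.
(* On a positive element two nonnegative terms add up to 0, so the form of [f] vanishes there. This
   is applied twice, exchanging [f] with [g] and [t] with [1 - t]. *)
have pos_sum0 (f g : os_elt E -> bop (hilbC R) (hilbC R)) (t : R) :
    QS E (hilbC R) f -> QS E (hilbC R) g -> 0 < t -> 0 <= 1 - t ->
    delta0 E = t%:C *: (f : os_elt E -> bop _ _) + (1 - t)%:C *: g -> f = delta0 E.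
  move=> fQS gQS t0 t1 fg; apply/funext => x.
  have [flin _ _] := fQS.
  apply: (vanish_on_positives Egen flin ler01) => [y|y y0].
    by rewrite mul1r QS_norm.
  have fy h : inner (f y h) h = 0.
    have := QS_positive fQS y0 h; have := QS_positive gQS y0 h.
    have : 0 = t%:C * inner (f y h) h + (1 - t)%:C * inner (g y h) h.
      have := congr1 (fun F : os_elt E -> bop _ _ => inner (F y h) h) fg.
      rewrite linear0l => ->.
      by rewrite -!linearZl_LR -linearDl.
    move=> e gy fy; apply/le_anti; rewrite fy andbT.
    have tC : 0 < t%:C :> C by rewrite ltcR.
    rewrite -(pmulr_rle0 _ tC) -[leLHS](addrK ((1 - t)%:C * inner (g y h) h)).
    by rewrite -e sub0r oppr_le0 mulr_ge0// ler0c.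
  apply/val_inj/funext => h.
  exact: (positive_op_kernel (QS_positive fQS y0) (fy h)).1.
split=> // f g t fQS gQS /andP[t0 t1] fg; split.
  by apply: (pos_sum0 f g t) => //; rewrite subr_ge0 ltW.
apply: (pos_sum0 g f (1 - t)) => //; first by rewrite subr_gt0.
  by rewrite opprB addrCA subrr addr0 ltW.
by rewrite opprB addrCA subrr addr0 fg addrC.
Qed.

Lemma zero_dilation_maximal (K : hilbertType R) :
  dilation_maximal ((fun=> 0) : os_elt E -> bop K K).
Proof.
move=> L psi V psiQS [_ VE].
have [psi_lin _ _] := psiQS.
have psi0 x : positive_op (val x) -> forall h,
    psi x (V h) = 0 /\ forall k, inner (psi x k) (V h) = 0.
  move=> x0 h; apply: positive_op_kernel; first exact: QS_positive.
  (* The compression of [psi x] by [V] is zero, so its form vanishes at [V h]. *)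
  have := congr1 (fun T : bop K K => inner h (T h)) (VE x).
  rewrite linear0r /= -adjointE => /esym; rewrite innerC => /eqP.
  by rewrite conjC_eq0 => /eqP.
have psiV x h : psi x (V h) = 0.
  apply: (@vanish_on_positives _ _ _ Egen L (fun y => psi y (V h)) `|V h|) => //.
  - by move=> a y z; rewrite psi_lin.
  - by move=> y; rewrite mulrC (le_trans (bop_normP _ _))// ler_wpM2r// QS_norm.
  - by move=> y /psi0/(_ h)[].
(* The inner product is linear in its first argument, so the pairing with a fixed [V h] is again a
   bounded linear map on [E]. *)
have Vpsi x k h : inner (psi x k) (V h) = 0.
  apply: (@vanish_on_positives _ _ _ Egen C^o (fun y => inner (psi y k) (V h))
            (`|k| * `|V h|)) => //.
  - by move=> a y z; rewrite psi_lin; exact: linearPl.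
  - exact: mulr_ge0.
  - move=> y; rewrite (le_trans (inner_CS _ _))// mulrAC ler_wpM2r//.
    by rewrite mulrC (le_trans (bop_normP _ _))// ler_wpM2r// QS_norm.
  - by move=> y /psi0/(_ h)[].
exists (ocompl_restriction Vpsi); first exact: ocompl_restriction_QS.
(* On the left [psi x] kills [V h]; on the right the zero map contributes [V 0 = 0]. *)
move=> x h k; rewrite linearD/= psiV add0r.
by rewrite linear0 add0r.
Qed.

End Extremality.

Theorem theorem1 (R : realType) (H : hilbertType R) (E : opSystem H) :
  approx_generated_by_positives E <-> extremal_point (delta0 E).
Proof.
split=> [Egen|]; last exact: extremal_generated.
by split; [exact: delta0_extreme|exact: zero_dilation_maximal].
Qed.
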